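(* Let $P$ be a bounded, ranked poset of length $n\ge1$ and let $t$ be a positive integer. Then \[\sum_{j=1}^n\mu\big(\widehat{I_j(P)}\big)t^j=-\mu\big((P^\ast\ast T_{t,n})^+\big),\] where $P^\ast$ is the dual of $P$.
   Context: For a bounded poset $X$, $\mu(X)=\mu_X(\hat0_X,\hat1_X)$ is its Möbius invariant. For a poset $X$, $\widehat X$ is $X$ with a new minimum and a new maximum adjoined, and $X^+$ is $X$ with only a new maximum adjoined. $P^-=P\setminus\{\hat0_P\}$. $C_n$ is the chain $1<2<\dots<n$. $T_{t,n}$ is a poset whose Hasse diagram is a complete $t$-ary tree of height $n$ (every non-leaf has exactly $t$ children, all leaves at distance $n$ from the root) with the root at the bottom. For ranked posets $X,Y$ with rank functions $r_X,r_Y$ (normalized so that minimal elements have rank $0$), the Rees product $X\ast Y=\{(x,y)\in X\times Y: r_X(x)\ge r_Y(y)\}$ with $(x_1,y_1)\le(x_2,y_2)$ iff $x_1\le x_2$, $y_1\le y_2$ and $r_X(x_2)-r_X(x_1)\ge r_Y(y_2)-r_Y(y_1)$. For $j\in[n]$, $I_j(P)=\{z\in P^-\ast C_n: z<(\hat1_P,j)\}$. *)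

(* Defs.v *)
From HB Require Import structures.
From mathcomp Require Import all_boot all_order all_algebra.
From mathcomp Require Import zify.

Set Implicit Arguments.
Unset Strict Implicit.
Unset Printing Implicit Defensive.

Import Order.TTheory GRing.Theory Num.Theory.

Local Open Scope order_scope.

(* Display shared by all the posets constructed below. *)
Fact poset_display : Order.disp_t. Proof. exact: Order.Disp tt tt. Qed.

Section Posets.
Variables (d : Order.disp_t) (X : finPOrderType d).

Definition chain (c : {set X}) : bool :=
  [forall x in c, forall y in c, x >=< y].

(* A chain with k + 1 elements has length k. *)
Definition poset_length : nat := \max_(c : {set X} | chain c) #|c|.-1.

(* The greatest length of a chain with all its elements below x; in a ranked
   poset this is the rank function, see rank_functionE. *)
Definition rank (x : X) : nat :=
  \max_(c : {set X} | chain c && [forall y in c, y <= x]) #|c|.-1.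

Definition minimal (x : X) : Prop := forall y, y <= x -> y = x.

Definition covers (x y : X) : Prop := x < y /\ forall z, ~~ (x < z < y).

Definition rank_function (r : X -> nat) : Prop :=
  (forall x, minimal x -> r x = 0%N) /\
  (forall x y, covers x y -> r y = (r x).+1).

Definition ranked : Prop := exists r, rank_function r.

(* The recursion mu x x = 1 and mu x y = - sum_(x <= z < y) mu x z, iterated
   at most k times; #|X| iterations are enough, see mobius_rec. *)
Fixpoint mobius_iter (k : nat) (x y : X) : int :=
  if x == y then 1%R else
  if k is k'.+1 then (- \sum_(z : X | (x <= z < y)%O) mobius_iter k' x z)%R else 0%R.

Definition mobius : X -> X -> int := mobius_iter #|X|.

End Posets.

Arguments poset_length {d} X.
Arguments ranked {d} X.

Section PosetFacts.
Variables (d : Order.disp_t) (X : finPOrderType d).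
Implicit Types (x y : X) (r : X -> nat).

Lemma mobius_iter_stable k x y :
  (#|[set z : X | (z < y)%O]| <= k)%N ->
  mobius_iter k x y = mobius_iter k.+1 x y.
Proof.
elim: k y => [|k IH] y hk /=; case: eqP => // nxy.
  rewrite big1 ?oppr0 // => z /andP[_ zy].
  by move: hk; rewrite leqn0 cards_eq0 => /eqP/setP/(_ z); rewrite !inE zy.
congr (- _)%R; apply: eq_bigr => z /andP[_ zy]; apply: IH.
rewrite -ltnS (leq_trans _ hk) //; apply/proper_card/properP; split.
  by apply/subsetP => u; rewrite !inE => /lt_trans; apply.
by exists z; rewrite !inE ?ltxx.
Qed.

Lemma mobiusxx x : mobius x x = 1%R.
Proof. by rewrite /mobius; case: #|X| => [|k] /=; rewrite eqxx. Qed.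

Lemma mobius_rec x y : x != y ->
  mobius x y = (- \sum_(z : X | (x <= z < y)%O) mobius x z)%R.
Proof.
move=> nxy; rewrite /mobius mobius_iter_stable ?max_card //=.
by rewrite (negPf nxy).
Qed.

Lemma rank_function_lt r x y : rank_function r -> x < y -> (r x < r y)%N.
Proof.
move=> [_ hc].
have [k] := ubnP #|[set z : X | x < z < y]|; elim: k y => // k IH y hk xy.
have [/existsP[z /andP[xz zy]]|hn] := boolP [exists z, x < z < y].
  have sub : [set u : X | x < u < z] \proper [set u | x < u < y].
    apply/properP; split.
      by apply/subsetP=> u; rewrite !inE => /andP[-> /lt_trans]; apply.
    by exists z; rewrite !inE ?xz ?zy ?ltxx ?andbF.
  have [z' /andP[xz' cz']] : {z' | (x < z' < y) &&
      [forall u, ~~ (z' < u < y)]}.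
    have hz : x < z < y by rewrite xz zy.
    have [u /andP[xu uy] hmax] := @arg_maxnP X z (fun u => x < u < y)
      (fun u => #|[set v : X | v < u]|) hz.
    exists u; rewrite xu uy /=; apply/forallP => v; apply/negP => /andP[uv vy].
    have := hmax v; rewrite (lt_trans xu uv) vy => /(_ isT).
    apply/negP; rewrite -ltnNge; apply/proper_card/properP; split.
      by apply/subsetP=> w; rewrite !inE => /lt_trans; apply.
    by exists u; rewrite !inE ?ltxx.
  have /andP[xz1 zy1] := xz'.
  have cov : covers z' y by split=> // u; exact: (forallP cz').
  rewrite (hc _ _ cov) ltnS ltnW // IH // -ltnS (leq_trans _ hk) // ltnS.
  apply/proper_card/properP; split.
    by apply/subsetP=> u; rewrite !inE => /andP[-> /lt_trans]; apply.
  by exists z'; rewrite !inE ?xz1 ?zy1 ?ltxx ?andbF.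
rewrite (hc x y) //; split=> // z; apply: contra hn => h.
by apply/existsP; exists z.
Qed.

Lemma rank_functionE r : rank_function r -> r =1 @rank d X.
Proof.
move=> hr x; apply/eqP; rewrite eqn_leq; apply/andP; split; last first.
  apply/bigmax_leqP => c /andP[/forall_inP hc /forall_inP hx].
  have inj : {in c &, injective r}.
    move=> u v uc vc e; have /forall_inP/(_ v vc) := hc u uc.
    case: comparableP => // h _; have := rank_function_lt hr h; lia.
  have sz : (#|c| <= (r x).+1)%N.
    rewrite -[X in (_ <= X)%N](card_ord) -(card_in_imset (f := fun u =>
        inord (r u) : 'I_(r x).+1)); first exact: max_card.
    have hle u : u \in c -> (r u < (r x).+1)%N.
      move=> /hx; rewrite le_eqVlt => /predU1P[->//|/(rank_function_lt hr)]; lia.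
    by move=> u v uc vc /(congr1 val); rewrite /= !inordK ?hle // => /inj; apply.
  lia.
suff [c [hc hx sz]] : exists c : {set X},
    [/\ chain c, [forall y in c, y <= x] & #|c| = (r x).+1].
  have -> : r x = #|c|.-1 by rewrite sz.
  by rewrite /rank (bigD1 c) ?hc ?hx //= leq_maxl.
have [k] := ubnP (r x); elim: k x => // k IH x hk.
have [/existsP[y yx]|hn] := boolP [exists y, y < x]; last first.
  have mx : minimal x.
    move=> y; rewrite le_eqVlt => /predU1P[//|yx].
    by case/existsP: hn; exists y.
  exists [set x]; rewrite cards1 hr.1 //; split=> //.
    apply/forall_inP => u /set1P ->; apply/forall_inP => v /set1P ->.
    by rewrite comparablexx.
  by apply/forall_inP => u /set1P ->.
have [z [zx cz]] : exists z, z < x /\ forall u, ~~ (z < u < x).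
  have [u ux hmax] := @arg_maxnP X y (fun u => u < x)
    (fun u => #|[set v : X | v < u]|) yx.
  exists u; split=> // v; apply/negP => /andP[uv vx].
  have := hmax v vx.
  apply/negP; rewrite -ltnNge; apply/proper_card/properP; split.
    by apply/subsetP=> w; rewrite !inE => /lt_trans; apply.
  by exists u; rewrite !inE ?ltxx.
have rzx : r x = (r z).+1 by apply: hr.2.
have [|c [/forall_inP hc /forall_inP hx sz]] := IH z; first by lia.
have cx u : u \in c -> u < x by move=> /hx uz; exact: le_lt_trans zx.
exists (x |: c); split.
- apply/forall_inP => u /setU1P[->|uc]; apply/forall_inP => v /setU1P[->|vc].
  + exact: comparablexx.
  + by rewrite /Order.comparable (ltW (cx v vc)) orbT.
  + by rewrite /Order.comparable (ltW (cx u uc)).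
  + by have /forall_inP := hc u uc; apply.
- by apply/forall_inP => u /setU1P[->//|/cx/ltW].
- by rewrite cardsU1 sz rzx; case: (boolP (x \in c)) => // /cx; rewrite ltxx.
Qed.

End PosetFacts.

Definition mobius_invariant d (X : finTBPOrderType d) : int :=
  mobius (\bot : X) \top.

Definition subposet d (X : finPOrderType d) (p : pred X) := {x : X | p x}.
HB.instance Definition _ d (X : finPOrderType d) (p : pred X) :=
  Finite.on (subposet p).
HB.instance Definition _ d (X : finPOrderType d) (p : pred X) :=
  SubType.on (subposet p).
HB.instance Definition _ d (X : finPOrderType d) (p : pred X) :=
  [SubChoice_isSubPOrder of subposet p by <: with poset_display].

Definition minus_bot d (P : finTBPOrderType d) :=
  subposet [pred x : P | x != \bot].
HB.instance Definition _ d (P : finTBPOrderType d) :=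
  Order.FinPOrder.on (minus_bot P).

(* with_top X is X^+ : Some x is an element x of X and None is the new
   maximum; with_bot is similar, with None the new minimum. *)

Definition with_top d (X : finPOrderType d) := option X.
Definition with_bot d (X : finPOrderType d) := option X.

Section WithTop.
Variables (d : Order.disp_t) (X : finPOrderType d).

HB.instance Definition _ := Finite.on (with_top X).

Definition with_top_le (x y : with_top X) : bool :=
  match x, y with
  | _, None => true
  | None, Some _ => false
  | Some a, Some b => a <= b
  end.

Fact with_top_le_refl : reflexive with_top_le.
Proof. by case=> /=. Qed.
Fact with_top_le_anti : antisymmetric with_top_le.
Proof. by move=> [a|] [b|] //= /le_anti ->. Qed.
Fact with_top_le_trans : transitive with_top_le.
Proof. by move=> [b|] [a|] [c|] //=; apply: le_trans. Qed.

HB.instance Definition _ := Order.Le_isPOrder.Build poset_display (with_top X)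
  with_top_le_refl with_top_le_anti with_top_le_trans.

Fact with_top_lex1 (x : with_top X) : x <= (None : with_top X).
Proof. by case: x. Qed.
HB.instance Definition _ :=
  Order.hasTop.Build poset_display (with_top X) with_top_lex1.

End WithTop.

HB.instance Definition _ d (X : finBPOrderType d) :=
  Order.hasBottom.Build poset_display (with_top X)
    (bottom := Some \bot)
    (fun x => match x return (Some \bot : with_top X) <= x with
              | Some a => le0x a | None => isT end).

Section WithBot.
Variables (d : Order.disp_t) (X : finPOrderType d).

HB.instance Definition _ := Finite.on (with_bot X).

Definition with_bot_le (x y : with_bot X) : bool :=
  match x, y with
  | None, _ => true
  | Some _, None => false
  | Some a, Some b => a <= b
  end.

Fact with_bot_le_refl : reflexive with_bot_le.
Proof. by case=> /=. Qed.
Fact with_bot_le_anti : antisymmetric with_bot_le.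
Proof. by move=> [a|] [b|] //= /le_anti ->. Qed.
Fact with_bot_le_trans : transitive with_bot_le.
Proof. by move=> [b|] [a|] [c|] //=; apply: le_trans. Qed.

HB.instance Definition _ := Order.Le_isPOrder.Build poset_display (with_bot X)
  with_bot_le_refl with_bot_le_anti with_bot_le_trans.

Fact with_bot_le0x (x : with_bot X) : (None : with_bot X) <= x.
Proof. by case: x. Qed.
HB.instance Definition _ :=
  Order.hasBottom.Build poset_display (with_bot X) with_bot_le0x.

End WithBot.

Definition hat d (X : finPOrderType d) := with_top (with_bot X).
HB.instance Definition _ d (X : finPOrderType d) :=
  Order.FinTBPOrder.on (hat X).

Definition rees d1 d2 (X : finPOrderType d1) (Y : finPOrderType d2) :=
  {p : X * Y | rank p.2 <= rank p.1}%N.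

Section Rees.
Variables (d1 d2 : Order.disp_t).
Variables (X : finPOrderType d1) (Y : finPOrderType d2).

HB.instance Definition _ := Finite.on (rees X Y).
HB.instance Definition _ := SubType.on (rees X Y).

Definition rees_le (p q : rees X Y) : bool :=
  let: (x1, y1) := val p in let: (x2, y2) := val q in
  [&& x1 <= x2, y1 <= y2 &
      ((rank x2)%:Z - (rank x1)%:Z >= (rank y2)%:Z - (rank y1)%:Z)%R].

Fact rees_le_refl : reflexive rees_le.
Proof. by move=> [[x y] h]; rewrite /rees_le /= !lexx /=; lia. Qed.

Fact rees_le_anti : antisymmetric rees_le.
Proof.
move=> [[x1 y1] h1] [[x2 y2] h2]; rewrite /rees_le /=.
case/andP => /and3P[hx hy _] /and3P[hx' hy' _]; apply: val_inj => /=.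
by congr (_, _); apply: le_anti; apply/andP.
Qed.

Fact rees_le_trans : transitive rees_le.
Proof.
move=> [[x2 y2] h2] [[x1 y1] h1] [[x3 y3] h3]; rewrite /rees_le /=.
move=> /and3P[hx hy hr] /and3P[hx' hy' hr'].
rewrite (le_trans hx hx') (le_trans hy hy') /=; lia.
Qed.

HB.instance Definition _ := Order.Le_isPOrder.Build poset_display (rees X Y)
  rees_le_refl rees_le_anti rees_le_trans.

End Rees.

Section ReesBottom.
Variables (d1 d2 : Order.disp_t).
Variables (X : finBPOrderType d1) (Y : finBPOrderType d2).

Lemma rank_bot d (Z : finBPOrderType d) : rank (\bot : Z) = 0%N.
Proof.
apply/eqP; rewrite -leqn0; apply/bigmax_leqP => c /andP[_ /forall_inP hc].
have: (#|c| <= 1)%N; last by case: #|c| => [|[]].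
rewrite -(cards1 (\bot : Z)); apply/subset_leq_card/subsetP => z /hc.
by rewrite lex0 inE.
Qed.

Fact rees_bot_subproof : (rank (\bot : Y) <= rank (\bot : X))%N.
Proof. by rewrite !rank_bot. Qed.

Definition rees_bot : rees X Y := exist _ (\bot, \bot) rees_bot_subproof.

Fact rees_le0x (p : rees X Y) : rees_bot <= p.
Proof.
case: p => [[x y] h]; rewrite /Order.le /= /rees_le /= !le0x !rank_bot /=.
by move: h => /=; lia.
Qed.

HB.instance Definition _ :=
  Order.hasBottom.Build poset_display (rees X Y) rees_le0x.

End ReesBottom.

(* The complete t-ary tree of height n: its nodes are the words of length at
   most n on t letters, ordered by prefix, so that the root is the empty word
   and the children of a word w of length < n are the t words rcons w a. *)

Definition tree (t n : nat) := {bseq n of 'I_t}.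

Section Tree.
Variables t n : nat.

HB.instance Definition _ := Finite.on (tree t n).

Definition tree_le (v w : tree t n) : bool := prefix v w.

Fact tree_le_refl : reflexive tree_le.
Proof. by move=> v; exact: prefix_refl. Qed.

Fact tree_le_anti : antisymmetric tree_le.
Proof.
move=> v w /andP[]; rewrite /tree_le => /prefixP[s e] /prefixP[s' e'].
apply: val_inj => /=; move: (e'); rewrite e => /(congr1 size).
rewrite !size_cat => h; have /size0nil s0 : size s = 0%N by lia.
by rewrite s0 cats0.
Qed.

Fact tree_le_trans : transitive tree_le.
Proof. by move=> w v u; exact: prefix_trans. Qed.

HB.instance Definition _ := Order.Le_isPOrder.Build poset_display (tree t n)
  tree_le_refl tree_le_anti tree_le_trans.

Definition tree_root : tree t n := [bseq].

Fact tree_le0x (v : tree t n) : tree_root <= v.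
Proof. exact: prefix0s. Qed.

HB.instance Definition _ :=
  Order.hasBottom.Build poset_display (tree t n) tree_le0x.

Lemma tree_coversP (v w : tree t n) :
  covers v w <-> exists a, w = rcons v a :> seq 'I_t.
Proof.
have ltE (u u' : tree t n) : (u < u') = (size u < size u')%N && prefix u u'.
  rewrite lt_neqAle /Order.le /= /tree_le.
  case: (boolP (prefix u u')) => [/prefixP[s e]|]; rewrite ?andbF //= !andbT.
  rewrite -val_eqE /= e size_cat; case: s {e} => [|a s] /=.
    by rewrite cats0 eqxx addn0 ltnn.
  rewrite addnS ltnS leq_addr; apply/eqP => /(congr1 size).
  by rewrite size_cat /=; lia.
split=> [[]|[a e]].
  rewrite ltE => /andP[lt /prefixP[[|a s] e]] h.
    by move: lt; rewrite e cats0 ltnn.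
  exists a; case: s e => [|b s] e; first by rewrite e cats1.
  have hs : (size (rcons v a) <= n)%N.
    by apply: leq_trans (size_bseq w); rewrite e size_rcons size_cat /=; lia.
  have := h (Bseq hs); rewrite !ltE /= e size_rcons size_cat /= ltnSn -cats1.
  by rewrite prefix_prefix -[_ :: _ :: _]cat1s catA prefix_prefix /= addnS addnS /=; lia.
split=> [|u]; rewrite !ltE ?e size_rcons ?ltnSn -?cats1 ?prefix_prefix //.
by apply/negP => /andP[/andP[? _] /andP[? _]]; lia.
Qed.

End Tree.

(* The chain C_n = {1 < ... < n} is represented by 'I_n, the ordinal j
   standing for the element j + 1 of C_n. *)

Section Ideal.
Variables (d : Order.disp_t) (P : finTBPOrderType d) (n : nat).
Hypothesis lenP : poset_length P = n.

Fact top_neq_bot (j : 'I_n) : (\top : P) != \bot.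
Proof.
apply/eqP => e; have : (poset_length P <= 0)%N; last first.
  by rewrite lenP; case: j; case: n.
apply/bigmax_leqP => c _; have: (#|c| <= 1)%N; last by case: #|c| => [|[]].
rewrite -(cards1 (\bot : P)); apply/subset_leq_card/subsetP => z _.
by rewrite inE -lex0 -e lex1.
Qed.

Definition minus_top (j : 'I_n) : minus_bot P := exist _ \top (top_neq_bot j).

Fact rees_top_subproof (j : 'I_n) : (rank j <= rank (minus_top j))%N.
Proof.
have rj : (rank j <= j)%N.
  apply/bigmax_leqP => c /andP[_ /forall_inP hc].
  have: (#|c| <= j.+1)%N; last by lia.
  rewrite -[X in (_ <= X)%N]card_ord -(card_in_imset (f := fun u : 'I_n =>
      inord u : 'I_j.+1)); first exact: max_card.
  move=> u v /hc uj /hc vj /(congr1 val).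
  by rewrite /= !inordK ?ltnS // => /val_inj.
apply: leq_trans rj _.
have [c hc e] : {c : {set P} | chain c & poset_length P = #|c|.-1}.
  apply: eq_bigmax_cond; apply/card_gt0P; exists set0.
  by apply/forall_inP => x; rewrite inE.
pose c' := [set z : minus_bot P | val z \in c].
have cc' : (#|c| <= #|c'|.+1)%N.
  rewrite (leq_trans (_ : _ <= #|\bot |: [set val z | z in c']|)%N) //.
    apply/subset_leq_card/subsetP => x xc; rewrite !inE.
    case: eqP => //= /eqP x0; apply/imsetP.
    by exists (exist _ x x0) => //; rewrite inE.
  rewrite cardsU1 card_imset //; last exact: val_inj.
  by rewrite -add1n leq_add2r; case: (_ \in _).
have hc' : chain c' && [forall y in c', y <= minus_top j].
  apply/andP; split; last first.
    by apply/forall_inP => y _; rewrite leEsub /= lex1.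
  apply/forall_inP => x; rewrite inE => xc.
  apply/forall_inP => y; rewrite inE => yc.
  by have /forall_inP/(_ _ xc)/forall_inP/(_ _ yc) := hc.
rewrite /rank (bigD1 c') //= leq_max; apply/orP; left.
have jc : (j <= #|c'|.-1)%N by move: cc' (ltn_ord j) e; rewrite lenP; lia.
exact: jc.
Qed.

Definition rees_top (j : 'I_n) : rees (minus_bot P) 'I_n :=
  exist _ (minus_top j, j) (rees_top_subproof j).

Definition ideal (j : 'I_n) :=
  subposet [pred z : rees (minus_bot P) 'I_n | z < rees_top j].
HB.instance Definition _ (j : 'I_n) := Order.FinPOrder.on (ideal j).

End Ideal.

(* Main.v *)
(* Write R for the Rees product of P^* with a chain 0 < ... < n, and let S_k be
   the sum of mu(bot, z) over the z in R at height k of the chain. A lower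
   interval of P^* * T_(t,n) below (x, w) is carried isomorphically onto the one
   of R below (x, |w|), and there are t^k words of length k, so the right-hand
   side is sum_k S_k t^k; also S_0 = 0, because S_0 sums mu over the interval
   below (0_P, 0). Dually, (x, i) |-> (x, j - i) carries I_j(P) with its top,
   upside down, onto the elements of R of height at most j below (0_P, j + 1).
   Since mu sums to 0 over the whole interval below (0_P, j + 1), mu of the hat
   of I_j(P) is S_(j + 1). Here j counts from 0. *)
Require Import Defs.
From mathcomp Require Import all_boot all_order all_algebra.
From mathcomp Require Import zify.

Set Implicit Arguments.
Unset Strict Implicit.
Unset Printing Implicit Defensive.

Import Order.TTheory GRing.Theory Num.Theory.

Local Open Scope ring_scope.

(** * Möbius functions: summation, duality, transport along a map *)

Section Mobius.
Context {d : Order.disp_t} {X : finPOrderType d}.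
Implicit Types x y z : X.

Lemma sum_mobius x y : (x <= y)%O ->
  \sum_(z : X | (x <= z <= y)%O) mobius x z = (x == y)%:Z.
Proof.
move=> xy; rewrite (bigD1 y) /=; last by rewrite xy lexx.
have [<-|nxy] := eqVneq x y.
  rewrite mobiusxx big1 ?addr0 // => z /andP[/andP[xz zx]].
  by rewrite eq_le xz zx.
rewrite (mobius_rec nxy); apply/eqP; rewrite addrC subr_eq0; apply/eqP.
by apply: eq_bigl => z; rewrite lt_neqAle andbA andbAC.
Qed.

End Mobius.

Lemma mobius_dual d (X : finPOrderType d) (x y : X) : (x <= y)%O ->
  mobius x y = mobius (y : X^d) (x : X^d).
Proof.
move=> xy.
have dualE (z : X) : (z <= y)%O ->
    \sum_(w : X | (z <= w <= y)%O) mobius (y : X^d) w = (z == y)%:Z.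
  move=> zy; rewrite eq_sym -(@sum_mobius _ X^d y z) //.
  by apply: eq_bigl => w; rewrite !leEdual andbC.
(* mu * zeta * mu', where mu' is the dual Moebius function, is associated in
   the two possible ways. *)
pose F z w := mobius x z * mobius (y : X^d) (w : X^d).
have sumz : \sum_(z : X | (x <= z <= y)%O)
    \sum_(w : X | (z <= w <= y)%O) F z w = mobius x y.
  rewrite (bigD1 y) /= ?xy ?lexx // -mulr_sumr dualE // eqxx mulr1.
  rewrite big1 ?addr0 // => z /andP[/andP[xz zy] nzy].
  by rewrite -mulr_sumr dualE // (negPf nzy) mulr0.
rewrite -sumz.
rewrite (exchange_big_dep (fun w : X => (x <= w <= y)%O)) /=; last first.
  by move=> z w /andP[xz _] /andP[zw ->]; rewrite (le_trans xz).
(* With [w] outermost, the inner sum is that of [mobius x] over [[x, w]], which vanishes for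
   [w != x]; the term [w = x] leaves the dual value at [x]. *)
rewrite (bigD1 x) /= ?xy ?lexx // [X in _ + X]big1 ?addr0.
  rewrite (bigD1 x) /= ?xy ?lexx // /F mobiusxx mul1r big1 ?addr0 //.
  move=> z /andP[/andP[/andP[xz _] /andP[zx _]]].
  by rewrite eq_le xz zx.
move=> w /andP[/andP[xw wy] nwx]; rewrite -mulr_suml.
rewrite (eq_bigl (fun z : X => (x <= z <= w)%O)); last first.
  move=> z; rewrite wy andbT -andbA; case: (x <= z)%O => //=.
  by apply/andb_idl => zw; apply: le_trans zw wy.
by rewrite sum_mobius // eq_sym (negPf nwx) mul0r.
Qed.

(** The two hypotheses make [f] an isomorphism of [[x, y]] onto [[f x, f y]] and ask nothing of [f]
    elsewhere. The recursion sees only these intervals, so induction on the number of elements below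
    [y] carries the values over. *)
Lemma mobius_morph d d' (X : finPOrderType d) (Y : finPOrderType d')
    (f : X -> Y) (x y : X) : (x <= y)%O ->
    {in [set z | x <= z <= y]%O &, injective f} ->
    (forall z, (x <= z <= y)%O ->
       f @: [set u | x <= u <= z]%O = [set v | f x <= v <= f z]%O) ->
  mobius x y = mobius (f x) (f y).
Proof.
have [k] := ubnP #|[set z : X | (z < y)%O]|; elim: k y => // k IH y hk xy.
move=> finj fim.
have [<-|nxy] := eqVneq x y; first by rewrite !mobiusxx.
have nfxy : f x != f y.
  by apply: contra_neq nxy => /finj; apply; rewrite inE !lexx ?xy.
rewrite !mobius_rec //; congr (- _).
have fim' : [set v | f x <= v < f y]%O = f @: [set u | x <= u < y]%O.
  apply/setP => v; rewrite inE lt_neqAle andbCA.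
  have -> : (f x <= v <= f y)%O = (v \in f @: [set u | x <= u <= y]%O).
    by rewrite fim ?xy ?lexx ?inE.
  apply/andP/imsetP => [[nv /imsetP[u]]|[u]]; rewrite inE => /andP[xu uy] ev.
    exists u => //; rewrite inE xu lt_neqAle uy andbT.
    by apply: contraNneq nv => <-; rewrite ev.
  rewrite ev; split; last by apply: imset_f; rewrite inE xu ltW.
  apply/eqP => /finj e; suff e' : u = y by rewrite e' ltxx in uy.
  by apply: e; rewrite inE ?xu ?xy ?lexx // ltW.
transitivity (\sum_(v in f @: [set u | x <= u < y]%O) mobius (f x) v);
  last first.
  by apply: eq_bigl => v; rewrite -fim' inE.
rewrite big_imset /=; last first.
  by move=> u v; rewrite !inE => /andP[xu uy] /andP[xv vy]; apply: finj;
    rewrite inE ?xu ?xv ltW.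
apply: eq_big => [z|z /andP[xz zy]]; first by rewrite inE.
apply: IH => //.
- rewrite -ltnS (leq_trans _ hk) // ltnS; apply/proper_card/properP; split.
    by apply/subsetP => u; rewrite !inE => /lt_trans; apply.
  by exists z; rewrite !inE ?ltxx.
- move=> u v; rewrite !inE => /andP[xu uz] /andP[xv vz]; apply: finj;
    rewrite inE ?xu ?xv /= ltW //;
    [exact: le_lt_trans uz zy | exact: le_lt_trans vz zy].
- by move=> u /andP[xu uz]; apply: fim; rewrite xu (le_trans uz) // ltW.
Qed.

(** * Ranks in chains, trees, duals and [minus_bot P] *)

Section Ranks.

Lemma rank_ord n (i : 'I_n) : rank i = i.
Proof.
rewrite -(rank_functionE (r := fun i : 'I_n => val i)) //.
split=> [x xmin|x y [xy nxy]].
  by case: n {i} x xmin => [[]//|n] x xmin; rewrite -(xmin ord0).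
have lt : (x < y)%N by [].
have [le|gt] := leqP y x.+1; first by apply/eqP; rewrite eqn_leq le lt.
have h : (x.+1 < n)%N by apply: ltn_trans gt (ltn_ord y).
by have := nxy (Ordinal h); rewrite !ltEord /= gt leqnn.
Qed.

Lemma rank_tree t n (w : tree t n) : rank w = size w.
Proof.
rewrite -(rank_functionE (r := fun w : tree t n => size w)) //.
split=> [x xmin|x y /tree_coversP[a ->]]; last by rewrite size_rcons.
by rewrite -(xmin (tree_root t n)) // le0x.
Qed.

Variables (d : Order.disp_t) (P : finTBPOrderType d).
Implicit Types x y : P.
Hypothesis rankedP : ranked P.

Lemma rank_functionP : rank_function (@rank d P).
Proof.
have [r hr] := rankedP; have e := rank_functionE hr.
by split=> [x|x y]; rewrite -!e; [apply: hr.1|apply: hr.2].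
Qed.

Lemma rank_lt x y : (x < y)%O -> (rank x < rank y)%N.
Proof. exact: rank_function_lt rank_functionP. Qed.

Lemma rank_le x y : (x <= y)%O -> (rank x <= rank y)%N.
Proof. by rewrite le_eqVlt => /predU1P[->//|/rank_lt/ltnW]. Qed.

Lemma rank_top : rank (\top%O : P) = poset_length P.
Proof.
apply: eq_bigl => c; rewrite andb_idr // => _.
by apply/forall_inP => y _; apply: lex1.
Qed.

Lemma rank_gt0 x : (0 < rank x)%N = (x != \bot%O).
Proof.
have [->|nx] := eqVneq x \bot%O; first by rewrite rank_bot.
by rewrite -(rank_bot P) rank_lt // lt0x.
Qed.

Lemma rank_le_length x : (rank x <= poset_length P)%N.
Proof. by rewrite -rank_top rank_le ?lex1. Qed.

Lemma rank_dual x : rank (x : P^d) = (poset_length P - rank x)%N.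
Proof.
rewrite -(rank_functionE
  (r := fun x : P^d => poset_length P - rank (x : P))%N) //.
split=> [y ymin|y z [yz nyz]].
  have -> : y = \top%O :> P by rewrite (ymin (\top%O : P)) // leEdual lex1.
  by rewrite rank_top subnn.
have cov : covers (z : P) (y : P).
  by split=> // u; have := nyz u; rewrite !ltEdual andbC.
have := rank_le_length (y : P); rewrite (rank_functionP.2 _ _ cov); lia.
Qed.

(** The minimal elements left after removing the bottom are the atoms, of rank 1 in [P], and covers
    among the remaining elements are covers in [P]. *)
Lemma rank_minus_bot (x : minus_bot P) : rank x = (rank (val x)).-1.
Proof.
rewrite -(rank_functionE (r := fun x : minus_bot P => (rank (val x)).-1)) //.
split=> [y ymin|y z [yz nyz]].
  have cov : covers \bot%O (val y).
    split=> [|u]; first by rewrite lt0x; apply: (valP y).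
    apply/negP => /andP[u0 uy]; move: u0; rewrite lt0x => u0.
    have := ymin (exist _ u u0); rewrite leEsub /= ltW // => /(_ isT) e.
    by rewrite -e /= ltxx in uy.
  by rewrite (rank_functionP.2 _ _ cov) rank_bot.
have cov : covers (val y) (val z).
  split=> // u; apply/negP => /andP[yu uz].
  have u0 : u != \bot%O by rewrite -lt0x (le_lt_trans _ yu) ?le0x.
  by have := nyz (exist _ u u0); rewrite !ltEsub /= yu uz.
have := rank_functionP.2 _ _ cov; have := valP y; rewrite /= -rank_gt0; lia.
Qed.

End Ranks.

(** * Levels of the tree, and adjoining a maximum *)

Lemma card_tree_level t n k : (k <= n)%N ->
  #|[set w : tree t n | size w == k]| = (t ^ k)%N.
Proof.
move=> kn; rewrite -[in RHS](card_ord t) -card_tuple.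
pose f (w : k.-tuple 'I_t) : tree t n :=
  widen_bseq kn (bseq_of_tuple w).
rewrite -(card_imset (f := f)); last first.
  by move=> u v /(congr1 val) /= /val_inj.
apply: eq_card => w; rewrite inE; apply/eqP/imsetP => [e|[u _ ->]]; last first.
  exact: size_tuple.
by exists (Tuple (introT eqP e)) => //; apply: val_inj.
Qed.

Lemma mobius_with_top d (Q : finBPOrderType d) :
  mobius_invariant (with_top Q) = - \sum_(q : Q) mobius \bot%O q.
Proof.
rewrite /mobius_invariant mobius_rec //; congr (- _).
rewrite (reindex_omap Some id) /=; last by case.
apply: eq_big => [q|q _]; first by rewrite eqxx andbT lt_neqAle lex1 le0x.
apply/esym/mobius_morph; rewrite ?le0x //; first by move=> u v _ _ [].
move=> z _; apply/setP => -[u|]; rewrite !inE; last first.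
  by rewrite andbF; apply/imsetP => -[].
by rewrite mem_imset ?inE // => x y [].
Qed.

(** * Rees products with the dual of [P], and the poset R *)

Section ReesDual.
Variables (d : Order.disp_t) (P : finTBPOrderType d) (n : nat).
Hypotheses (rankedP : ranked P) (lenP : poset_length P = n).

(** Ranks in [P^d] are [n] minus ranks in [P]. Moving them to the other side turns the Rees
    conditions, here and in [rees_dual_leE], into comparisons of sums, free of truncated
    subtraction. *)
Lemma rees_dual_rank d' (Y : finPOrderType d') (p : P * Y) :
  (rank p.2 <= rank (p.1 : P^d))%N = (rank p.2 + rank p.1 <= n)%N.
Proof.
by have := rank_le_length rankedP p.1; rewrite rank_dual // lenP => le; lia.
Qed.

Lemma rees_dualP d' (Y : finPOrderType d') (p : rees P^d Y) :
  (rank (val p).2 + rank ((val p).1 : P) <= n)%N.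
Proof. by rewrite -(rees_dual_rank (val p)); apply: (valP p). Qed.

Lemma rees_dual_leE d' (Y : finPOrderType d') (p q : rees P^d Y) :
  (p <= q)%O = [&& ((val q).1 <= (val p).1 :> P)%O, ((val p).2 <= (val q).2)%O &
    (rank (val q).2 + rank ((val q).1 : P) <=
     rank (val p).2 + rank ((val p).1 : P))%N].
Proof.
rewrite {1}/Order.le /= /rees_le; case: p q => [[x1 y1] h1] [[x2 y2] h2] /=.
rewrite leEdual; congr [&& _, _ & _].
rewrite !rank_dual //.
have := rank_le_length rankedP (x1 : P).
have := rank_le_length rankedP (x2 : P).
lia.
Qed.

Local Notation rees_chain := (rees P^d 'I_n.+1).
Implicit Types p : rees_chain.

Lemma rees_chain_leE p p' :
  (p <= p')%O = [&& ((val p').1 <= (val p).1 :> P)%O,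
    ((val p).2 <= (val p').2)%N &
    ((val p').2 + rank ((val p').1 : P) <=
     (val p).2 + rank ((val p).1 : P))%N].
Proof. by rewrite rees_dual_leE !rank_ord leEord. Qed.

Lemma rees_chainP p : ((val p).2 + rank ((val p).1 : P) <= n)%N.
Proof. by have := rees_dualP p; rewrite rank_ord. Qed.

Fact rees_chain_pair_subproof (x : P) (k : nat) (h : (k + rank x <= n)%N) :
  (rank (inord k : 'I_n.+1) <= rank (x : P^d))%N.
Proof. by rewrite (rees_dual_rank (x, inord k)) rank_ord inordK //; lia. Qed.

(** The bound [h] forces [k <= n], so [inord] never returns its default value. *)
Definition rees_chain_pair (x : P) (k : nat) (h : (k + rank x <= n)%N) :
  rees_chain := exist _ (x : P^d, inord k) (rees_chain_pair_subproof h).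

Lemma rees_chain_eq p p' :
    (val p).1 = (val p').1 -> (val p).2 = (val p').2 :> nat -> p = p'.
Proof.
move=> e1 e2; apply: val_inj.
case: p p' e1 e2 => [[x i] /= _] [[y j] /= _] -> e.
by congr (_, _); apply: val_inj.
Qed.

Fact rees_chain_bot_subproof : (0 + rank (\top%O : P) <= n)%N.
Proof. by rewrite rank_top // lenP. Qed.

Definition rees_chain_bot := rees_chain_pair rees_chain_bot_subproof.

Lemma rees_chain_le0x p : (rees_chain_bot <= p)%O.
Proof.
rewrite rees_chain_leE /= lex1 inordK // leq0n rank_top // lenP.
exact: rees_chainP.
Qed.

(** This is S_k of the overview, with [rees_chain] as R. *)
Definition level_sum (k : nat) : int :=
  \sum_(p : rees_chain | (val p).2 == k :> nat) mobius rees_chain_bot p.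

Lemma level_sum0 : (0 < n)%N -> level_sum 0 = 0.
Proof.
move=> n0; have h : (0 + rank (\bot%O : P) <= n)%N by rewrite rank_bot.
(* For [n = 0] the interval would be a single point, with sum 1. *)
have nb : rees_chain_bot != rees_chain_pair h.
  apply/eqP => /(congr1 (fun p => rank ((val p).1 : P))).
  by rewrite /= rank_bot rank_top // lenP; lia.
transitivity (\sum_(p : rees_chain |
    (rees_chain_bot <= p <= rees_chain_pair h)%O) mobius rees_chain_bot p);
  last by rewrite sum_mobius ?rees_chain_le0x // (negPf nb).
apply: eq_bigl => p; rewrite rees_chain_le0x.
rewrite rees_chain_leE /= le0x inordK // rank_bot.
by lia.
Qed.

(** * The tree side: replacing words by their lengths *)

Section Tree.
Variable t : nat.
Implicit Types q u : rees P^d (tree t n).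

Fact rees_tree_pair_subproof (x : P) (w : tree t n) :
  (size w + rank x <= n)%N -> (rank w <= rank (x : P^d))%N.
Proof. by rewrite (rees_dual_rank (x, w)) rank_tree. Qed.

Definition rees_tree_pair (x : P) (w : tree t n)
    (h : (size w + rank x <= n)%N) : rees P^d (tree t n) :=
  exist _ (x : P^d, w) (rees_tree_pair_subproof h).

Fact tree_to_chain_subproof q : (size (val q).2 + rank ((val q).1 : P) <= n)%N.
Proof. by have := rees_dualP q; rewrite rank_tree. Qed.

Definition tree_to_chain q : rees_chain :=
  rees_chain_pair (tree_to_chain_subproof q).

Lemma tree_to_chain2 q : (val (tree_to_chain q)).2 = size (val q).2 :> nat.
Proof. by rewrite inordK // ltnS size_bseq. Qed.

Lemma rees_tree_leE q u :
  (q <= u)%O = [&& ((val u).1 <= (val q).1 :> P)%O, prefix (val q).2 (val u).2 &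
    (size (val u).2 + rank ((val u).1 : P) <=
     size (val q).2 + rank ((val q).1 : P))%N].
Proof. by rewrite rees_dual_leE !rank_tree. Qed.

(** A fixed word has exactly one prefix of each length up to its own, so replacing words by lengths
    is bijective on the interval below [q], though not globally. *)
Lemma mobius_tree_to_chain q :
  mobius \bot%O q = mobius rees_chain_bot (tree_to_chain q).
Proof.
have -> : rees_chain_bot = tree_to_chain \bot%O.
  by apply: rees_chain_eq => //; rewrite tree_to_chain2 inordK.
apply: mobius_morph; rewrite ?le0x //.
  move=> u v; rewrite !inE !le0x !rees_tree_leE /=.
  move=> /and3P[_ uq _] /and3P[_ vq _] e.
  apply: val_inj; case: u v uq vq e => [[x w] hw] [[y w'] hw'] /= wq w'q e.
  have := congr1 (fun p => nat_of_ord (val p).2) e.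
  rewrite !tree_to_chain2 /= => es.
  have -> : x = y := congr1 (fun p => (val p).1) e.
  congr (_, _); apply: val_inj.
  by move: wq w'q; rewrite !prefixE es => /eqP wq /eqP; apply: etrans.
move=> u _; apply/setP => p; rewrite !inE.
apply/imsetP/andP => [[v]|[_]].
  rewrite inE !le0x /= rees_tree_leE => /and3P[h1 h2 h3] ->.
  split; rewrite rees_chain_leE !tree_to_chain2 /=.
    rewrite lex1 /= rank_top // lenP add0n.
    exact: tree_to_chain_subproof.
  by rewrite h1 h3 size_prefix.
rewrite rees_chain_leE tree_to_chain2 => /and3P[h1 h2 h3].
(* The preimage of [p] below [u] must carry the prefix of the word of [u] whose length is the height
   of [p]. *)
have hs : (size (take (val p).2 (val u).2) <= n)%N.
  by rewrite size_takel // (leq_trans h2) ?size_bseq.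
pose w : tree t n := Bseq hs.
have sw : size w = (val p).2 by rewrite /= size_takel.
have hw : (size w + rank ((val p).1 : P) <= n)%N by rewrite sw rees_chainP.
exists (rees_tree_pair hw).
  rewrite inE le0x rees_tree_leE /= h1 sw h3 andbT.
  by rewrite -{2}(cat_take_drop (val p).2 (val u).2) prefix_prefix.
by apply: rees_chain_eq => //; rewrite tree_to_chain2 sw.
Qed.

Lemma mobius_rees_tree :
  mobius_invariant (with_top (rees P^d (tree t n))) =
  - \sum_(k < n.+1) level_sum k * t%:Z ^+ k.
Proof.
rewrite mobius_with_top; congr (- _).
(* Both sides become sums over [p] in R: the left one by fibres of [tree_to_chain], the right one
   because each [p] lies on a single level. *)
rewrite (partition_big tree_to_chain predT) //=.
under [RHS]eq_bigr do rewrite mulr_suml.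
rewrite [RHS](exchange_big_dep predT) //=; apply: eq_bigr => p _.
rewrite (bigD1 (val p).2) //= [X in _ + X]big1 ?addr0; last first.
  by move=> k /andP[/eqP e]; rewrite -val_eqE /= e eqxx.
rewrite (eq_bigr (fun=> mobius rees_chain_bot p)); last first.
  by move=> q /eqP <-; apply: mobius_tree_to_chain.
rewrite sumr_const -mulr_natr; congr (_ * _).
rewrite -[t%:Z]natz -natrX; congr _%:R.
have pn : ((val p).2 <= n)%N by rewrite -ltnS.
rewrite -(card_tree_level t pn).
have hw (w : tree t n) : size w = (val p).2 ->
    (size w + rank ((val p).1 : P) <= n)%N by move=> ->; apply: rees_chainP.
(* In the fibre over [p] the first coordinate is fixed, and the word can be any one whose length is
   the height of [p]. *)
rewrite -(card_in_imset (f := fun q : rees P^d (tree t n) => (val q).2)).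
  apply: eq_card => w; rewrite !inE; apply/imsetP/eqP => [[q hq ->]|sw].
    by have /eqP <- : tree_to_chain q == p := hq; rewrite tree_to_chain2.
  exists (rees_tree_pair (hw w sw)) => //.
  rewrite unfold_in eqxx andTb; apply/eqP/ord_inj.
  by rewrite tree_to_chain2 -sw.
move=> q u; rewrite !unfold_in => /andP[/eqP eq _] /andP[/eqP eu _] e.
apply: val_inj; rewrite [LHS]surjective_pairing [RHS]surjective_pairing e.
by congr (_, _); apply: etrans eq (esym eu).
Qed.

End Tree.

(** * The ideal side: turning [I_j(P)] upside down inside R *)

Section Ideal.
Variable j : 'I_n.
Local Notation I := (ideal lenP j).
Implicit Types z : I.

Definition ideal_elt z : P := val (val (val z)).1.
Definition ideal_index z : nat := (val (val z)).2.

(** Ranks in [minus_bot P] are one less than in [P]; the shift cancels in differences. *)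
Lemma rees_minus_bot_leE (z w : rees (minus_bot P) 'I_n) :
  (z <= w)%O = [&& (val (val z).1 <= val (val w).1)%O,
    ((val z).2 <= (val w).2)%N &
    ((val w).2 + rank (val (val z).1) <= (val z).2 + rank (val (val w).1))%N].
Proof.
rewrite {1}/Order.le /= /rees_le; case: z w => [[x i] hi] [[y k] hk] /=.
rewrite !rank_ord !rank_minus_bot // leEord leEsub; congr [&& _, _ & _].
have := valP x; have := valP y; rewrite /= -!rank_gt0 //; lia.
Qed.

Lemma ideal_leE z (w : I) :
  (z <= w)%O = [&& (ideal_elt z <= ideal_elt w)%O,
    (ideal_index z <= ideal_index w)%N &
    (ideal_index w + rank (ideal_elt z) <=
     ideal_index z + rank (ideal_elt w))%N].
Proof. by rewrite leEsub rees_minus_bot_leE. Qed.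

(** The first bound is the Rees condition, strict because of the rank shift. The next two come from
    [z] lying below [(\top, j)], and the last from [z] differing from it. *)
Lemma ideal_bounds z : [/\ (ideal_index z < rank (ideal_elt z))%N,
  (ideal_index z <= j)%N, (j + rank (ideal_elt z) <= ideal_index z + n)%N &
  (ideal_index z < j)%N || (ideal_elt z != \top%O)].
Proof.
have := valP z; rewrite inE lt_neqAle rees_minus_bot_leE /= lex1 /=.
rewrite rank_top // lenP => /and3P[nz h1 h2]; split=> //.
  have := valP (val z); rewrite rank_ord rank_minus_bot //.
  have := valP (val (val z)).1; rewrite /= -rank_gt0 // /ideal_index /ideal_elt.
  by move=> r0; rewrite -ltnS (prednK r0).
rewrite ltn_neqAle h1 andbT -negb_and.
apply: contraNN nz => /andP[/eqP e1 /eqP e2].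
apply/eqP/val_inj; rewrite [LHS]surjective_pairing /=.
by congr (_, _); apply: val_inj.
Qed.

Fact ideal_to_chain_subproof z :
  (j - ideal_index z + rank (ideal_elt z) <= n)%N.
Proof. by have [_ h1 h2 _] := ideal_bounds z; lia. Qed.

Definition ideal_to_chain z : rees_chain :=
  rees_chain_pair (ideal_to_chain_subproof z).

Lemma ideal_to_chain2 z :
  (val (ideal_to_chain z)).2 = (j - ideal_index z)%N :> nat.
Proof. by rewrite inordK // ltnS; have := ideal_to_chain_subproof z; lia. Qed.

Lemma ideal_to_chain_le z (w : I) :
  (ideal_to_chain z <= ideal_to_chain w)%O = (w <= z)%O.
Proof.
rewrite ideal_leE rees_chain_leE !ideal_to_chain2 /=.
by have [_ h1 _ _] := ideal_bounds z; have [_ h2 _ _] := ideal_bounds w; lia.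
Qed.

(** Only [(\top, j)] could land on the bottom, and the ideal excludes it. *)
Lemma ideal_to_chain_nbot z : ideal_to_chain z != rees_chain_bot.
Proof.
have [_ h1 _ h2] := ideal_bounds z.
apply: contraTneq h2 => e.
have := congr1 (fun p => nat_of_ord (val p).2) e.
rewrite ideal_to_chain2 /= inordK // => h.
have -> : ideal_elt z = \top%O := congr1 (fun p => (val p).1) e.
by rewrite eqxx orbF -leqNgt -subn_eq0 h.
Qed.

(** The inverse is [(x, k) |-> (x, j - k)]. The last hypothesis is the Rees condition for
    [(x, j - k)] and forces [x] off the bottom; the bound [k + rank x <= n] valid in R puts the pair
    below [(\top, j)]. *)
Lemma ideal_to_chain_onto p : p != rees_chain_bot -> ((val p).2 <= j)%N ->
  (j < (val p).2 + rank ((val p).1 : P))%N -> exists z, ideal_to_chain z = p.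
Proof.
move=> pn0 pj pr; set x : P := (val p).1; set k : nat := (val p).2.
have x0 : x != \bot%O
  by rewrite -rank_gt0 //; move: pr pj; rewrite -/x -/k; lia.
have hj : (j - k < n)%N by rewrite (leq_ltn_trans (leq_subr _ _)).
pose i := Ordinal hj; pose y : minus_bot P := exist _ x x0.
have hw : (rank (y, i).2 <= rank (y, i).1)%N.
  rewrite rank_ord rank_minus_bot //=; move: pr pj; rewrite -/x -/k; lia.
pose w : rees (minus_bot P) 'I_n := exist _ (y, i) hw.
have wt : (w < rees_top lenP j)%O.
  have h : (j + rank x <= j - k + n)%N.
    by have := rees_chainP p; rewrite -/x -/k; move: pj; rewrite -/k; lia.
  rewrite lt_neqAle rees_minus_bot_leE /= lex1 leq_subr rank_top // lenP h.
  rewrite !andbT; apply: contraNneq pn0 => e.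
  have e1 := congr1 (fun u : rees (minus_bot P) 'I_n => val (val u).1) e.
  have e2 := congr1 (fun u : rees (minus_bot P) 'I_n => (val u).2 : nat) e.
  apply/eqP; apply: rees_chain_eq; first exact: e1.
  rewrite /= inordK // -/k; move: pj e2; rewrite -/k /=; lia.
exists (exist _ w wt); apply: rees_chain_eq => //.
by rewrite ideal_to_chain2 /= /ideal_index /= subKn.
Qed.

Lemma ideal_to_chain_inj : injective ideal_to_chain.
Proof.
by move=> z w e; apply/le_anti; rewrite -!ideal_to_chain_le e lexx.
Qed.

(** The top of the hat stands for [(\top, j)] and goes to the bottom of R. The bottom of the hat,
    [Some None], only gets a default value, so the lemmas on this map exclude it. *)
Definition hat_to_chain (a : (hat I)^d) : rees_chain :=
  if a is Some (Some z) then ideal_to_chain z else rees_chain_bot.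

Lemma hat_to_chain_inj :
  {in [set a : (hat I)^d | (a : hat I) != \bot%O] &, injective hat_to_chain}.
Proof.
move=> [[z|]|] [[w|]|]; rewrite !inE //= => _ _ e.
- by rewrite (ideal_to_chain_inj e).
- by have := ideal_to_chain_nbot z; rewrite e eqxx.
- by have := ideal_to_chain_nbot w; rewrite e eqxx.
Qed.

Lemma hat_to_chain_range :
  hat_to_chain @: [set a : (hat I)^d | (a : hat I) != \bot%O] =
  [set p : rees_chain | ((val p).2 <= j)%N &
    (j < (val p).2 + rank ((val p).1 : P))%N].
Proof.
apply/setP => p; rewrite inE; apply/imsetP/andP => [[[[z|]|]]|[pj pr]].
- move=> _ -> /=; rewrite ideal_to_chain2.
  by have [h1 h2 _ _] := ideal_bounds z; split; rewrite ?leq_subr //=; lia.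
- by rewrite inE.
- by move=> _ ->; rewrite /= inordK // rank_top // lenP.
have [->|pn0] := eqVneq p rees_chain_bot; first by exists None; rewrite ?inE.
have [z <-] := ideal_to_chain_onto pn0 pj pr.
by exists (Some (Some z)); rewrite ?inE.
Qed.

Lemma mobius_hat_to_chain (a : (hat I)^d) : (a : hat I) != \bot%O ->
  @mobius _ (hat I)^d (\top%O : hat I) a =
  mobius rees_chain_bot (hat_to_chain a).
Proof.
move=> na.
have nbot (u : (hat I)^d) : (u <= a)%O -> (u : hat I) != \bot%O.
  by rewrite leEdual -!lt0x; apply: lt_le_trans; rewrite lt0x.
have le_top (u : (hat I)^d) : ((\top%O : hat I) <= u :> (hat I)^d)%O.
  by rewrite leEdual lex1.
rewrite -[rees_chain_bot]/(hat_to_chain (\top%O : hat I)).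
apply: mobius_morph; first exact: le_top.
  by move=> u v; rewrite !inE => /andP[_ /nbot hu] /andP[_ /nbot hv];
    apply: hat_to_chain_inj; rewrite inE.
move=> u /andP[_ /nbot nu]; apply/setP => p; rewrite !inE rees_chain_le0x /=.
apply/imsetP/idP => [[v]|pu].
  rewrite inE leEdual => /andP[_ vu] ->.
  case: u v nu vu => [[z|]|] [[w|]|] //= _; rewrite ?rees_chain_le0x //.
  by rewrite ideal_to_chain_le.
have [->|pn0] := eqVneq p rees_chain_bot.
  by exists (\top%O : hat I); rewrite // inE !le_top.
case: u nu pu => [[z|]|] //= _ pz; last first.
  by case/eqP: pn0; apply/le_anti; rewrite pz rees_chain_le0x.
(* The image is closed downwards: below the image of [z] heights stay at most [j], and height plus
   rank stays above [j]. *)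
have := pz; rewrite rees_chain_leE ideal_to_chain2 /= => /and3P[_ h1 h2].
have [h3 h4 _ _] := ideal_bounds z.
have pj : ((val p).2 <= j)%N by rewrite (leq_trans h1) ?leq_subr.
have [|w ew] := ideal_to_chain_onto pn0 pj; first by apply: leq_trans h2; lia.
exists (Some (Some w)) => //; rewrite inE le_top leEdual.
by move: pz; rewrite -ew ideal_to_chain_le.
Qed.

Lemma mobius_hat_ideal : mobius_invariant (hat I) = level_sum j.+1.
Proof.
have h : (j.+1 + rank (\bot%O : P) <= n)%N by rewrite rank_bot addn0.
pose b := rees_chain_pair h.
have nb : rees_chain_bot != b.
  apply/eqP => /(congr1 (fun p => rank ((val p).1 : P))).
  by rewrite /= rank_bot rank_top // lenP; have := ltn_ord j; lia.
have b2 : (val b).2 = j.+1 :> nat by rewrite inordK // ltnS ltn_ord.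
have leb p : (p <= b)%O = ((val p).2 <= j.+1)%N &&
    (j < (val p).2 + rank ((val p).1 : P))%N.
  by rewrite rees_chain_leE b2 /= le0x rank_bot addn0.
have : \sum_(p : rees_chain | (p <= b)%O) mobius rees_chain_bot p = 0.
  transitivity (\sum_(p : rees_chain | (rees_chain_bot <= p <= b)%O)
    mobius rees_chain_bot p);
    last by rewrite sum_mobius ?rees_chain_le0x // (negPf nb).
  by apply: eq_bigl => p; rewrite rees_chain_le0x.
(* At height [j.+1] the second condition of [leb] is automatic, so this slice is a whole level; the
   rest is the range of [hat_to_chain]. *)
rewrite (bigID (fun p : rees_chain => (val p).2 == j.+1 :> nat)) /=.
have -> : \sum_(p : rees_chain | (p <= b)%O && ((val p).2 == j.+1 :> nat))
    mobius rees_chain_bot p = level_sum j.+1.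
  by apply: eq_bigl => p; rewrite leb; lia.
move/eqP; rewrite addr_eq0 => /eqP ->.
(* In the dual the recursion starts at the top of the hat and sums over everything but its bottom,
   precisely where [hat_to_chain] is injective. *)
rewrite /mobius_invariant mobius_dual ?le0x // mobius_rec //; congr (- _).
transitivity (\sum_(p in hat_to_chain @:
      [set a : (hat I)^d | (a : hat I) != \bot%O])
    mobius rees_chain_bot p); last first.
  rewrite hat_to_chain_range; apply: eq_bigl => p; rewrite inE leb.
  by rewrite [RHS]andbAC; congr (_ && _); rewrite andbC -ltn_neqAle ltnS.
rewrite big_imset /=; last exact: hat_to_chain_inj.
apply: eq_big => [a|a].
  by rewrite inE lt_neqAle !leEdual le0x lex1 andbT.
rewrite lt_neqAle => /and3P[_ na _]; exact: mobius_hat_to_chain.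
Qed.

End Ideal.

End ReesDual.

Theorem theorem8p7 (d : Order.disp_t) (P : finTBPOrderType d) (n t : nat)
    (rankedP : ranked P) (lenP : poset_length P = n)
    (n_gt0 : (1 <= n)%N) (t_gt0 : (1 <= t)%N) :
  \sum_(j < n) mobius_invariant (hat (ideal lenP j)) * (t%:Z) ^+ j.+1
  = - mobius_invariant (with_top (rees P^d (tree t n))).
Proof.
(* Level 0 contributes nothing; level [j.+1] then meets the exponent [j.+1]. *)
rewrite (mobius_rees_tree rankedP lenP t) opprK big_ord_recl level_sum0 //.
rewrite mul0r add0r; apply: eq_bigr => j _.
by rewrite (mobius_hat_ideal rankedP).
Qed.
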